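(* Let $H$ be a complex Hilbert space of finite dimension $n$, and assume $\mathcal{F}=\{f_1,\ldots,f_m\}$ is a phase retrievable frame for $H$. Then there is a $\rho>0$ such that any set $\mathcal{F}'=\{f_1',\ldots,f_m'\}\subset H$ with $\|f_k-f_k'\|<\rho$ for all $1\leq k\leq m$ is also a phase retrievable frame for $H$.
   Context: $H$ is the complex Hilbert space $\mathbb{C}^n$ with the usual scalar product $\langle x,y\rangle=\sum_{k=1}^n x_k\overline{y_k}$ and the associated norm. Finite frame sets $\{f_1,\ldots,f_m\}$ are indexed families of vectors (repetitions allowed). Such a family is a frame for $H$ if there are constants $0<A\leq B<\infty$ with $A\|x\|^2\leq\sum_{k=1}^m|\langle x,f_k\rangle|^2\leq B\|x\|^2$ for all $x\in H$; in finite dimension this is equivalent to $\mathrm{span}\{f_1,\ldots,f_m\}=H$. On $H$ define $x\sim y$ if and only if there is $z\in\mathbb{C}$ with $|z|=1$ and $y=zx$; let $\hat{H}=H/\sim$ and let $\hat{x}$ denote the class of $x$. A frame $\{f_1,\ldots,f_m\}$ for $H$ is called phase retrievable if the (well-defined) map $\alpha:\hat{H}\to\mathbb{R}^m$, $(\alpha(\hat{x}))_k=|\langle x,f_k\rangle|$, $1\leq k\leq m$, is injective. *)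

(* Defs.v *)
From HB Require Import structures.
From mathcomp Require Import all_boot all_order all_algebra.
From mathcomp Require Import spectral complex boolp reals.
Set Implicit Arguments.
Unset Strict Implicit.
Unset Printing Implicit Defensive.
Import Order.TTheory GRing.Theory Num.Theory.
Local Open Scope ring_scope.
Local Open Scope complex_scope.
Local Open Scope quotient_scope.

(* C^n is 'rV[R[i]]_n with R : realType; its scalar product is the library's
   dotmx, linear in the first argument and conjugate-linear in the second. *)
Lemma dotmx_sum (R : realType) (n : nat) (x y : 'rV[R[i]]_n) :
  dotmx x y = \sum_(k < n) x 0 k * (y 0 k)^*%C.
Proof. by rewrite dotmxE mxE; apply: eq_bigr => k _; rewrite !mxE. Qed.

(* The modulus `|z| of z : R[i] is an element of R[i] with zero imaginary
   part; cabs z is the same number as an element of R. *)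
Definition cabs (R : realType) (z : R[i]) : R := complex.Re `|z|.

Lemma cabsE (R : realType) (z : R[i]) : (cabs z)%:C = `|z|.
Proof. by rewrite /cabs RRe_real ?normr_real. Qed.

Definition hnorm (R : realType) (n : nat) (x : 'rV[R[i]]_n) : R :=
  Num.sqrt (complex.Re (dotmx x x)).

Lemma hnormE (R : realType) (n : nat) (x : 'rV[R[i]]_n) :
  (hnorm x ^+ 2)%:C = dotmx x x.
Proof.
have x_ge0 : 0 <= dotmx x x.
  by rewrite dotmx_sum sumr_ge0 // => k _; apply: mul_conjC_ge0.
rewrite sqr_sqrtr ?RRe_real ?ger0_real //.
by rewrite -ler0c RRe_real ?ger0_real.
Qed.

Definition is_frame (R : realType) (n m : nat) (f : 'I_m -> 'rV[R[i]]_n) : Prop :=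
  exists A B : R, 0 < A /\ A <= B /\ forall x : 'rV[R[i]]_n,
    A * hnorm x ^+ 2 <= \sum_(k < m) cabs (dotmx x (f k)) ^+ 2 /\
    \sum_(k < m) cabs (dotmx x (f k)) ^+ 2 <= B * hnorm x ^+ 2.

Section PhaseQuotient.
Variables (R : realType) (n : nat).

Definition phase_eq : rel 'rV[R[i]]_n :=
  fun x y => `[< exists z : R[i], `|z| = 1 /\ y = z *: x >].

Lemma phase_eq_refl : reflexive phase_eq.
Proof. by move=> x; apply/asboolP; exists 1; rewrite normr1 scale1r. Qed.

Lemma phase_eq_sym : symmetric phase_eq.
Proof.
suff H x y : phase_eq x y -> phase_eq y x by move=> x y; apply/idP/idP; exact: H.
move=> /asboolP[z [z1 ->]]; apply/asboolP; exists z^-1.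
by rewrite normfV z1 invr1 scalerA mulVf ?scale1r // -normr_eq0 z1 oner_eq0.
Qed.

Lemma phase_eq_trans : transitive phase_eq.
Proof.
move=> y x w /asboolP[z [z1 ->]] /asboolP[z' [z'1 ->]]; apply/asboolP.
by exists (z' * z); rewrite normrM z1 z'1 mulr1 scalerA.
Qed.

Canonical phase_eq_equiv := EquivRel phase_eq phase_eq_refl phase_eq_sym phase_eq_trans.

Definition hat_space := {eq_quot phase_eq}.

End PhaseQuotient.

(* alpha is computed on a representative; alpha_pi says that the choice of the
   representative is immaterial. *)
Definition alpha (R : realType) (n m : nat) (f : 'I_m -> 'rV[R[i]]_n)
    (xh : hat_space R n) : 'rV[R]_m :=
  \row_(k < m) cabs (dotmx (repr xh) (f k)).

Lemma alpha_pi (R : realType) (n m : nat) (f : 'I_m -> 'rV[R[i]]_n)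
    (x : 'rV[R[i]]_n) :
  alpha f (\pi_(hat_space R n) x) = \row_(k < m) cabs (dotmx x (f k)).
Proof.
have /eqmodP/asboolP[z [z1 rE]] : x = repr (\pi_(hat_space R n) x)
  %[mod {eq_quot @phase_eq R n}] by rewrite reprK.
by apply/rowP => k; rewrite !mxE rE /cabs linearZl_LR normrM z1 mul1r.
Qed.

Definition phase_retrievable_frame (R : realType) (n m : nat)
    (f : 'I_m -> 'rV[R[i]]_n) : Prop :=
  is_frame f /\ injective (alpha f).

(* Main.v *)
Require Import Defs.
From mathcomp Require Import all_boot all_order all_algebra.
From mathcomp Require Import complex reals.
From mathcomp Require Import ring lra spectral boolp classical_sets.
From mathcomp Require Import topology normedtype derive realfun.

(** Injectivity of the phaseless measurements is a nondegeneracy property that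
    survives small perturbations because it can be tested on a compact set.

    Put u = x + y and v = x - y.  By polarization,
      |<x,g>|^2 - |<y,g>|^2 = Re (<u,g> conj <v,g>) =: cross u v g,
    which, unlike the left-hand side, is real bilinear in (u, v).  Replacing y
    by a unimodular multiple makes <x,y> real, and then <u,v> is real as well;
    moreover u and v are both nonzero unless x and y are equal up to a phase.
    Hence the measurements separate phase classes as soon as
      (S) for nonzero u, v with <u,v> real, some cross u v (f k) is nonzero
    ([cross_separating_alpha_inj]).  Conversely, if <u,v> is real and u, v are
    nonzero, then u + v and u - v are never equal up to a phase
    ([unimodular_sumdiff_eq0]), so injectivity implies (S)
    ([alpha_inj_cross_separating]).

    By bilinearity (S) only concerns unit vectors u and v, and the unit pairs
    with real scalar product form a compact set ([compact_unit_pairs]), on which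
    the sum over k of |cross u v (f k)| is bounded below by some c > 0
    ([cross_sum_lower_bound]).  Since cross u v g is locally Lipschitz in g,
    uniformly over unit u and v ([norm_cross_sub_le]), moving every f k by
    less than a small multiple of c preserves (S) ([cross_separating_perturb]).
    The frame inequalities survive by the triangle inequality
    ([is_frame_perturb]). *)

Set Implicit Arguments.
Unset Strict Implicit.
Unset Printing Implicit Defensive.
Import Order.TTheory GRing.Theory Num.Theory.
Import numFieldNormedType.Exports.
Local Open Scope ring_scope.
Local Open Scope complex_scope.

(** * Moduli of complex numbers *)

Section Complex.
Variable R : realType.
Implicit Types a b z : R[i].

Lemma cabs_sqr z : cabs z ^+ 2 = complex.Re z ^+ 2 + complex.Im z ^+ 2.
Proof. by rewrite /cabs normc_def /= sqr_sqrtr // addr_ge0 ?sqr_ge0. Qed.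

Lemma cabs_ge0 z : 0 <= cabs z.
Proof. by rewrite -ler0c cabsE. Qed.

Lemma cabsM a b : cabs (a * b) = cabs a * cabs b.
Proof. by apply: complexI; rewrite rmorphM /= !cabsE normrM. Qed.

Lemma cabsJ z : cabs z^* = cabs z.
Proof. by case: z => x y; rewrite /cabs !normc_def /= sqrrN. Qed.

Lemma ler_cabsD a b : cabs (a + b) <= cabs a + cabs b.
Proof. by rewrite -lecR rmorphD /= !cabsE ler_normD. Qed.

Lemma norm_Re_le_cabs z : `|complex.Re z| <= cabs z.
Proof. by rewrite -lecR cabsE normc_ge_Re. Qed.

Lemma norm_Im_le_cabs z : `|complex.Im z| <= cabs z.
Proof.
rewrite -ler_sqr ?nnegrE ?cabs_ge0 // real_normK ?num_real //.
by rewrite cabs_sqr lerDr sqr_ge0.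
Qed.

Lemma sqr_cabsB a b :
  cabs a ^+ 2 - cabs b ^+ 2 = complex.Re ((a + b) * (a - b)^*).
Proof. by rewrite !cabs_sqr; case: a b => [p q] [r s] /=; ring. Qed.

Lemma eq_cabs_sumdiff a b :
  (cabs (a + b) == cabs (a - b)) = (complex.Re (a * b^*) == 0).
Proof.
have polar : cabs (a + b) ^+ 2 - cabs (a - b) ^+ 2 =
    4 * complex.Re (a * b^*).
  by rewrite !cabs_sqr; case: a b => [p q] [r s] /=; ring.
rewrite -(@eqrXn2 _ 2) ?cabs_ge0 // -subr_eq0 polar mulf_eq0.
by rewrite (negPf (_ : 4 != 0)) ?pnatr_eq0.
Qed.

(** Writing a' = a - da and b' = b - db, the difference a b^* - a' b'^* is
    a db^* + da b^* - da db^*, whose terms are at most r d, d r and d d. *)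
Lemma norm_Re_mulJ_sub_le a a' b b' (r d : R) :
  cabs a <= r -> cabs b <= r -> cabs (a - a') <= d -> cabs (b - b') <= d ->
  `|complex.Re (a * b^*) - complex.Re (a' * b'^*)| <= d * (2 * r + d).
Proof.
move=> ar br dar dbr.
have -> : complex.Re (a * b^*) - complex.Re (a' * b'^*) =
    complex.Re (a * (b - b')^* + ((a - a') * b^* + - ((a - a') * (b - b')^*))).
  case: a a' b b' {ar br dar dbr}.
  by move=> p q [p1 q1] [p2 q2] [p3 q3] /=; ring.
have -> : d * (2 * r + d) = r * d + (d * r + d * d) by ring.
have cabsN z : cabs (- z) = cabs z by rewrite /cabs normrN.
apply: le_trans (norm_Re_le_cabs _) _.
apply: le_trans (ler_cabsD _ _) _; apply: lerD.
  by rewrite cabsM cabsJ ler_pM ?cabs_ge0.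
apply: le_trans (ler_cabsD _ _) _.
by rewrite cabsN !cabsM !cabsJ lerD // ler_pM ?cabs_ge0.
Qed.

Lemma phase_real z : exists2 w : R[i], `|w| = 1 & complex.Im (w * z) = 0.
Proof.
have [->|z0] := eqVneq z 0; first by exists 1; rewrite ?normr1 ?mulr0.
exists (z^* / `|z|).
  by rewrite normf_div normr_id normcJ divff ?normr_eq0.
by rewrite mulrAC [_^* * z]mulrC -normCK expr2 mulfK ?normr_eq0 // -cabsE.
Qed.

End Complex.

(** * The scalar product and the polarized intensity form *)

Section Hermitian.
Variables (R : realType) (n : nat).
Implicit Types u v x y g : 'rV[R[i]]_n.

(** Sesquilinearity is restated for dotmx itself: the generic lemmas produce
    its bundled form, which obstructs unification with plain dotmx. *)
Lemma dotmxJ u v : (dotmx v u)^* = dotmx u v.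
Proof. by rewrite [RHS]hermC expr0 mul1r. Qed.

Lemma dotmxDl u v g : dotmx (u + v) g = dotmx u g + dotmx v g.
Proof. exact: linearDl. Qed.

Lemma dotmxBl u v g : dotmx (u - v) g = dotmx u g - dotmx v g.
Proof. exact: linearBl. Qed.

Lemma dotmxDr u v g : dotmx g (u + v) = dotmx g u + dotmx g v.
Proof. exact: linearDr. Qed.

Lemma dotmxBr u v g : dotmx g (u - v) = dotmx g u - dotmx g v.
Proof. exact: linearBr. Qed.

Lemma dotmxZl (z : R[i]) u g : dotmx (z *: u) g = z * dotmx u g.
Proof. exact: linearZl_LR. Qed.

Lemma dotmxZr (z : R[i]) u g : dotmx g (z *: u) = z^* * dotmx g u.
Proof. exact: linearZr_LR. Qed.

Lemma cabs_dotmxZl (z : R[i]) u g :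
  cabs (dotmx (z *: u) g) = cabs z * cabs (dotmx u g).
Proof. by rewrite dotmxZl cabsM. Qed.

Lemma dotmx_eq0 u : (dotmx u u == 0) = (u == 0).
Proof. exact: (dnorm_eq0 (@dotmx R[i] n)). Qed.

Lemma hnorm_ge0 x : 0 <= hnorm x.
Proof. exact: sqrtr_ge0. Qed.

Lemma hnorm_gt0 x : (0 < hnorm x) = (x != 0).
Proof.
have <- : (hnorm x == 0) = (x == 0).
  by rewrite -dotmx_eq0 -hnormE -(inj_eq (@complexI R)) rmorphXn /= expf_eq0.
by rewrite lt_def hnorm_ge0 andbT.
Qed.

Lemma cabs_dotmx_le x y : cabs (dotmx x y) <= hnorm x * hnorm y.
Proof.
have [+ _] := CauchySchwarz (@dotmx R[i] n) x y.
rewrite /= -!hnormE -cabsE -(rmorphXn _ 2 (cabs _)) -rmorphM /= lecR -exprMn.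
by rewrite ler_sqr ?nnegrE ?mulr_ge0 ?hnorm_ge0 ?cabs_ge0.
Qed.

Lemma hnormZ (z : R[i]) x : hnorm (z *: x) = cabs z * hnorm x.
Proof.
apply/eqP; rewrite -(@eqrXn2 _ 2) ?mulr_ge0 ?hnorm_ge0 ?cabs_ge0 //.
rewrite -(inj_eq (@complexI R)) hnormE dotmxZl dotmxZr -hnormE.
by rewrite exprMn [eqbRHS]rmorphM /= mulrA (rmorphXn _ 2 (cabs z)) /=
  cabsE normCK.
Qed.

(** The polarization of the intensity |<x,g>|^2 with respect to the sum and the
    difference of two vectors; equivalently, the real symmetric bilinear form
    attached to the rank one operator x |-> <x,g> g. *)
Definition cross u v g : R := complex.Re (dotmx u g * (dotmx v g)^*).

Lemma cross_sumdiff x y g :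
  cross (x + y) (x - y) g = cabs (dotmx x g) ^+ 2 - cabs (dotmx y g) ^+ 2.
Proof. by rewrite sqr_cabsB /cross dotmxDl dotmxBl. Qed.

Lemma eq_cabs_dotmx_sumdiff u v g :
  (cabs (dotmx (u + v) g) == cabs (dotmx (u - v) g)) = (cross u v g == 0).
Proof. rewrite dotmxDl dotmxBl; exact: eq_cabs_sumdiff. Qed.

Lemma Im_dotmxZ (s t : R) u v :
  complex.Im (dotmx (s%:C *: u) (t%:C *: v)) = s * t * complex.Im (dotmx u v).
Proof. by rewrite dotmxZl dotmxZr; case: (dotmx u v) => [p q] /=; ring. Qed.

Lemma crossZ (s t : R) u v g :
  cross (s%:C *: u) (t%:C *: v) g = s * t * cross u v g.
Proof.
rewrite /cross [dotmx (_ *: u) _]dotmxZl [dotmx (_ *: v) _]dotmxZl.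
by case: (dotmx u g) (dotmx v g) => [p q] [r w] /=; ring.
Qed.

(** The bound does not mention u and v: this uniformity is what lets one radius
    serve all pairs of unit vectors. *)
Lemma norm_cross_sub_le u v g g' : hnorm u = 1 -> hnorm v = 1 ->
  `|cross u v g - cross u v g'| <=
    hnorm (g - g') * (2 * hnorm g + hnorm (g - g')).
Proof.
move=> u1 v1; set d := hnorm (g - g').
have bnd (w h : 'rV[R[i]]_n) : hnorm w = 1 -> cabs (dotmx w h) <= hnorm h.
  by move=> w1; have := cabs_dotmx_le w h; rewrite w1 mul1r.
have bndB (w : 'rV[R[i]]_n) : hnorm w = 1 ->
    cabs (dotmx w g - dotmx w g') <= d.
  by move=> w1; rewrite -dotmxBr bnd.
by apply: norm_Re_mulJ_sub_le; [exact: bnd|exact: bnd|exact: bndB|exact: bndB].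
Qed.

End Hermitian.

(** * Separation of phase classes in terms of the polarized form *)

Section Separation.
Variables (R : realType) (n m : nat).
Implicit Types (u v x y : 'rV[R[i]]_n) (f : 'I_m -> 'rV[R[i]]_n).

(** Condition (S) of the opening comment.  Requiring <u,v> to be real removes the
    trivial zeros of the form: cross u ('i u) g = 0 for all g. *)
Definition cross_separating f := forall u v,
  u != 0 -> v != 0 -> complex.Im (dotmx u v) = 0 ->
  exists k, cross u v (f k) != 0.

Lemma alpha_piP f x y :
  alpha f (\pi_(hat_space R n)%qT x) = alpha f (\pi_(hat_space R n)%qT y) <->
  forall k, cabs (dotmx x (f k)) = cabs (dotmx y (f k)).
Proof.
rewrite (alpha_pi f x) (alpha_pi f y); split => [xy k|xy].
  by have := congr1 (fun A : 'rV[R]_m => A 0 k) xy; rewrite [LHS]mxE [RHS]mxE.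
by apply: eq_mx => i k; apply: xy.
Qed.

(** Equality of the norms of u + v and u - v gives Re <u,v> = 0, hence
    <u,v> = 0.  Pairing u - v = z (u + v) with u then forces z = 1, and pairing
    it with v forces z = -1, unless u or v vanishes. *)
Lemma unimodular_sumdiff_eq0 u v (z : R[i]) :
  complex.Im (dotmx u v) = 0 -> `|z| = 1 -> u - v = z *: (u + v) ->
  u = 0 \/ v = 0.
Proof.
move=> uv z1 uvz.
have uv0 : dotmx u v = 0.
  have eqn : dotmx (u - v) (u - v) = dotmx (u + v) (u + v).
    by rewrite uvz -!hnormE hnormZ /cabs z1 mul1r.
  move: eqn; rewrite !dotmxBl !dotmxDl !dotmxBr !dotmxDr /=.
  rewrite -(dotmxJ v u); move: uv; case: (dotmx u v) => [p q] /= ->.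
  move: (dotmx u u) (dotmx v v) => [a b] [c d] [e _].
  by congr Complex; lra.
have vu0 : dotmx v u = 0 by rewrite -dotmxJ uv0 rmorph0.
have [u0|u0] := eqVneq u 0; [by left|right].
have uu : dotmx u u != 0 by rewrite dotmx_eq0.
have uvzw w : dotmx u w - dotmx v w = z * (dotmx u w + dotmx v w).
  by rewrite -dotmxBl -dotmxDl uvz dotmxZl.
have := uvzw u; rewrite vu0 subr0 addr0 -[X in X = _]mul1r => /(mulIf uu) z_eq1.
have := uvzw v; rewrite uv0 -z_eq1 mul1r sub0r add0r => /esym/eqP.
rewrite -addr_eq0 -mulr2n mulrn_eq0 /=.
by rewrite dotmx_eq0 => /eqP.
Qed.

(** If every cross u v (f k) vanished, then u + v and u - v would have the same
    measurements, hence be equal up to a phase. *)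
Lemma alpha_inj_cross_separating f : injective (alpha f) -> cross_separating f.
Proof.
move=> inj u v u0 v0 uv; apply: contrapT => /forallNP h.
have /alpha_piP : forall k,
    cabs (dotmx (u + v) (f k)) = cabs (dotmx (u - v) (f k)).
  by move=> k; apply/eqP; rewrite eq_cabs_dotmx_sumdiff; apply/negPn/negP/h.
move/inj/eqmodP/asboolP => [z [z1 zE]].
by have [u_eq0|v_eq0] := unimodular_sumdiff_eq0 uv z1 zE;
  [case/eqP: u0|case/eqP: v0].
Qed.

(** Two vectors x and y with the same measurements annihilate the forms at
    x + w y and x - w y, for any unimodular w.  Choosing w such that <x, w y> is
    real makes (S) applicable, so one of these two vectors is zero. *)
Lemma cross_separating_alpha_inj f : cross_separating f -> injective (alpha f).
Proof.
move=> sep X Y; rewrite -(reprK X) -(reprK Y).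
move: (repr X) (repr Y) => x y /alpha_piP axy.
have [w w1 wE] := phase_real (dotmx y x).
apply/eqmodP/asboolP.
have [xwy|xwy] := eqVneq (x + w *: y) 0.
  exists (- w^-1); split; first by rewrite normrN normfV w1 invr1.
  have wn0 : w != 0 by rewrite -normr_eq0 w1 oner_eq0.
  have /eqP := xwy; rewrite addr_eq0 => /eqP ->.
  by rewrite scalerN scaleNr opprK scalerA mulVf ?scale1r.
have [xwy'|xwy'] := eqVneq (x - w *: y) 0.
  exists (w^-1); split; first by rewrite normfV w1 invr1.
  have wn0 : w != 0 by rewrite -normr_eq0 w1 oner_eq0.
  have /eqP := xwy'; rewrite subr_eq0 => /eqP ->.
  by rewrite scalerA mulVf ?scale1r.
have [] := sep _ _ xwy xwy'.
  (* Im <x + w y, x - w y> = 2 Im <w y, x> *)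
  rewrite dotmxDl dotmxBr /= dotmxBr /=.
  have -> : dotmx x (w *: y) = (dotmx (w *: y) x)^* by rewrite dotmxJ.
  rewrite -!hnormE dotmxZl; move: wE.
  by case: (w * _) => p q /= ->; ring.
move=> k; rewrite cross_sumdiff cabs_dotmxZl (axy k).
have -> : cabs w = 1 by rewrite /cabs w1.
by rewrite mul1r subrr eqxx.
Qed.

End Separation.

(** * Continuity of complex-valued maps *)

Section ComplexContinuity.
Variables (R : realType) (T : topologicalType).
Implicit Types h g : T -> R[i].

(** Continuity into R[i] is expressed on real and imaginary parts, so that the
    topology is the real one, for which closed bounded sets are compact. *)
Definition ccontinuous h :=
  continuous (fun t => complex.Re (h t)) /\
  continuous (fun t => complex.Im (h t)).

Lemma ccontinuous_cst (z : R[i]) : ccontinuous (fun=> z).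
Proof. by split => t; apply: cvg_cst. Qed.

Lemma ccontinuousD h g :
  ccontinuous h -> ccontinuous g -> ccontinuous (fun t => h t + g t).
Proof.
move=> [hr hi] [gr gi]; split => t.
  have -> : (fun s => complex.Re (h s + g s)) =
      (fun s => complex.Re (h s) + complex.Re (g s)).
    by apply: funext => s; case: (h s) (g s) => [a b] [c d].
  by apply: cvgD; [exact: hr|exact: gr].
have -> : (fun s => complex.Im (h s + g s)) =
    (fun s => complex.Im (h s) + complex.Im (g s)).
  by apply: funext => s; case: (h s) (g s) => [a b] [c d].
by apply: cvgD; [exact: hi|exact: gi].
Qed.

Lemma ccontinuous_mulJ h g :
  ccontinuous h -> ccontinuous g -> ccontinuous (fun t => h t * (g t)^*).
Proof.
move=> [hr hi] [gr gi]; split => t.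
  have -> : (fun s => complex.Re (h s * (g s)^*)) =
      (fun s => complex.Re (h s) * complex.Re (g s) +
                complex.Im (h s) * complex.Im (g s)).
    by apply: funext => s; case: (h s) (g s) => [a b] [c d] /=; ring.
  by apply: cvgD; apply: cvgM; [exact: hr|exact: gr|exact: hi|exact: gi].
have -> : (fun s => complex.Im (h s * (g s)^*)) =
    (fun s => complex.Im (h s) * complex.Re (g s) -
              complex.Re (h s) * complex.Im (g s)).
  by apply: funext => s; case: (h s) (g s) => [a b] [c d] /=; ring.
by apply: cvgB; apply: cvgM; [exact: hi|exact: gr|exact: hr|exact: gi].
Qed.

Lemma ccontinuous_sum m (h : 'I_m -> T -> R[i]) :
  (forall k, ccontinuous (h k)) -> ccontinuous (fun t => \sum_(k < m) h k t).
Proof.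
move=> hc; elim: m h hc => [|m IH] h hc.
  have -> : (fun t => \sum_(k < 0) h k t) = (fun=> 0).
    by apply: funext => t; rewrite big_ord0.
  exact: ccontinuous_cst.
have -> : (fun t => \sum_(k < m.+1) h k t) =
    (fun t => \sum_(k < m) h (widen_ord (leqnSn m) k) t + h ord_max t).
  by apply: funext => t; rewrite big_ord_recr.
apply: ccontinuousD; last exact: hc.
by apply: (IH (fun k => h (widen_ord (leqnSn m) k))) => k; apply: hc.
Qed.

Lemma ccontinuous_dotmx n (u v : T -> 'rV[R[i]]_n) :
  (forall k, ccontinuous (fun t => u t 0 k)) ->
  (forall k, ccontinuous (fun t => v t 0 k)) ->
  ccontinuous (fun t => dotmx (u t) (v t)).
Proof.
move=> uc vc.
have -> : (fun t => dotmx (u t) (v t)) =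
    (fun t => \sum_(k < n) u t 0 k * (v t 0 k)^*).
  by apply: funext => t; rewrite dotmx_sum.
by apply: ccontinuous_sum => k; apply: ccontinuous_mulJ.
Qed.

End ComplexContinuity.

(** * The quantitative form of separation *)

Section LowerBound.
Local Open Scope classical_set_scope.
Variables (R : realType) (n m : nat).
Implicit Types (u v x y : 'rV[R[i]]_n) (f : 'I_m -> 'rV[R[i]]_n).

Lemma cabs_coord_le_hnorm x k : cabs (x 0 k) <= hnorm x.
Proof.
have xE : hnorm x ^+ 2 = \sum_(j < n) cabs (x 0 j) ^+ 2.
  apply: complexI; rewrite hnormE dotmx_sum rmorph_sum /=.
  by apply: eq_bigr => j _; rewrite rmorphXn /= cabsE normCK.
rewrite -ler_sqr ?nnegrE ?hnorm_ge0 ?cabs_ge0 // xE (bigD1 k) //=.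
by rewrite lerDl sumr_ge0 // => j _; rewrite sqr_ge0.
Qed.

Local Notation realvec := ('rV[R]_n * 'rV[R]_n)%type.

(** The coordinates of C^n as a real space, on which compactness is
    established. *)
Definition cplx (p : realvec) : 'rV[R[i]]_n := \row_k (p.1 0 k +i* p.2 0 k).

Lemma cplx_ReIm x :
  cplx (map_mx (@complex.Re R) x, map_mx (@complex.Im R) x) = x.
Proof. by apply/rowP => k; rewrite !mxE /=; case: (x 0 k). Qed.

Lemma ccontinuous_cplx (T : topologicalType) (g : T -> realvec) k :
  continuous g -> ccontinuous (fun t => cplx (g t) 0 k).
Proof.
move=> gc.
have rc : continuous (fun p : realvec => p.1 0 k).
  move=> p; apply: (@continuous_comp _ _ _ fst (fun y : 'rV[R]_n => y 0 k)).
    exact: cvg_fst.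
  exact: coord_continuous.
have ic : continuous (fun p : realvec => p.2 0 k).
  move=> p; apply: (@continuous_comp _ _ _ snd (fun y : 'rV[R]_n => y 0 k)).
    exact: cvg_snd.
  exact: coord_continuous.
split => t.
  have -> : (fun s => complex.Re (cplx (g s) 0 k)) = (fun s => (g s).1 0 k).
    by apply: funext => s; rewrite mxE.
  exact: (continuous_comp (gc t) (rc (g t))).
have -> : (fun s => complex.Im (cplx (g s) 0 k)) = (fun s => (g s).2 0 k).
  by apply: funext => s; rewrite mxE.
exact: (continuous_comp (gc t) (ic (g t))).
Qed.

Lemma ccontinuous_cplx1 k :
  ccontinuous (fun p : realvec * realvec => cplx p.1 0 k).
Proof. by apply: ccontinuous_cplx => p; exact: cvg_fst. Qed.

Lemma ccontinuous_cplx2 k :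
  ccontinuous (fun p : realvec * realvec => cplx p.2 0 k).
Proof. by apply: ccontinuous_cplx => p; exact: cvg_snd. Qed.

Definition unit_pairs : set (realvec * realvec) :=
  [set p | [/\ hnorm (cplx p.1) = 1, hnorm (cplx p.2) = 1
    & complex.Im (dotmx (cplx p.1) (cplx p.2)) = 0]].

Lemma compact_unit_pairs : compact unit_pairs.
Proof.
pose box := [set x : 'rV[R]_n | forall i, `[(-1 : R), 1] (x ord0 i)].
have cbox : compact box.
  apply: (@rV_compact R n (fun=> `[(-1 : R), 1])) => _.
  exact: segment_compact.
have cbox2 : compact (box `*` box) by exact: compact_setX.
apply: (subclosed_compact _ (compact_setX cbox2 cbox2)); last first.
  have inbox p : hnorm (cplx p) = 1 -> (box `*` box) p.
    move=> p1; have h k : cabs (cplx p 0 k) <= 1.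
      by rewrite -p1 cabs_coord_le_hnorm.
    split=> k /=; rewrite in_itv /= -ler_norml; apply: le_trans (h k).
      by have := norm_Re_le_cabs (cplx p 0 k); rewrite mxE.
    by have := norm_Im_le_cabs (cplx p 0 k); rewrite mxE.
  by move=> [p q] [/= p1 q1 _]; split; exact: inbox.
have -> : unit_pairs = (fun p => hnorm (cplx p.1)) @^-1` [set r | r = 1] `&`
    ((fun p => hnorm (cplx p.2)) @^-1` [set r | r = 1] `&`
     (fun p => complex.Im (dotmx (cplx p.1) (cplx p.2))) @^-1` [set r | r = 0]).
  by apply/seteqP; split=> p /=; [case|case=> ? []].
have closed_fiber (g : realvec * realvec -> R) a :
    continuous g -> closed (g @^-1` [set r | r = a]).
  by move=> gc; apply: closed_comp => [p _|]; [exact: gc|exact: closed_eq].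
apply: closedI; [|apply: closedI]; apply: closed_fiber.
- move=> p; apply: (continuous_comp
    ((ccontinuous_dotmx ccontinuous_cplx1 ccontinuous_cplx1).1 p)).
  exact: sqrt_continuous.
- move=> p; apply: (continuous_comp
    ((ccontinuous_dotmx ccontinuous_cplx2 ccontinuous_cplx2).1 p)).
  exact: sqrt_continuous.
- exact: (ccontinuous_dotmx ccontinuous_cplx1 ccontinuous_cplx2).2.
Qed.

(** The sum is continuous and, by (S), positive on the compact set of unit
    pairs, so its minimum there is positive. *)
Lemma cross_sum_lower_bound f : cross_separating f ->
  exists2 c : R, 0 < c & forall u v, hnorm u = 1 -> hnorm v = 1 ->
    complex.Im (dotmx u v) = 0 -> c <= \sum_(k < m) `|cross u v (f k)|.
Proof.
move=> sep.
pose S p := \sum_(k < m) `|cross (cplx p.1) (cplx p.2) (f k)|.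
have inK u v : hnorm u = 1 -> hnorm v = 1 -> complex.Im (dotmx u v) = 0 ->
    exists2 p, unit_pairs p & \sum_(k < m) `|cross u v (f k)| = S p.
  move=> u1 v1 uv.
  exists ((map_mx (@complex.Re R) u, map_mx (@complex.Im R) u),
          (map_mx (@complex.Re R) v, map_mx (@complex.Im R) v)).
    by rewrite /unit_pairs /= !cplx_ReIm.
  by rewrite /S /= !cplx_ReIm.
(* There are no unit vectors when n = 0, and then any c will do. *)
have [K0|K0] := pselect (unit_pairs !=set0); last first.
  exists 1 => // u v u1 v1 uv.
  by have [p Kp _] := inK _ _ u1 v1 uv; case: K0; exists p.
have fc k j : ccontinuous (fun p : realvec * realvec => f k 0 j).
  exact: ccontinuous_cst.
have Sc : continuous S.
  move=> p; apply: cvg_big => [|k _]; first exact: add_continuous.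
  apply: cvg_norm.
  exact: (ccontinuous_mulJ
    (ccontinuous_dotmx ccontinuous_cplx1 (fc k))
    (ccontinuous_dotmx ccontinuous_cplx2 (fc k))).1.
have [p Kp minp] := compact_EVT_min K0 compact_unit_pairs
  (continuous_subspaceT Sc).
exists (S p).
  move: Kp; rewrite inE => -[u1 v1 uv].
  have [k k0] : exists k, cross (cplx p.1) (cplx p.2) (f k) != 0.
    by apply: sep => //; rewrite -hnorm_gt0 ?u1 ?v1.
  rewrite lt_def sumr_ge0 ?andbT => [|j _]; last exact: normr_ge0.
  rewrite psumr_neq0 => [|j _]; last exact: normr_ge0.
  by apply/hasP; exists k; rewrite ?mem_index_enum //= normr_gt0.
move=> u v u1 v1 uv; have [q Kq ->] := inK _ _ u1 v1 uv.
by apply: minp; rewrite inE.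
Qed.

End LowerBound.

(** * Perturbation of the frame vectors *)

Section Perturbation.
Variables (R : realType) (n m : nat).
Implicit Types (u v x y : 'rV[R[i]]_n) (f : 'I_m -> 'rV[R[i]]_n).

(** From a^2 <= (e + b)^2 <= 2 e^2 + 2 b^2. *)
Lemma sqr_half_subr_le (a b d e : R) :
  0 <= a -> 0 <= b -> d <= e -> a <= d + b -> a ^+ 2 / 2 - e ^+ 2 <= b ^+ 2.
Proof.
move=> a0 b0 de adb.
have ac : a ^+ 2 <= (e + b) ^+ 2 by rewrite ler_sqr ?nnegrE; lra.
by have := sqr_ge0 (e - b); move: ac; rewrite sqrrD sqrrB; lra.
Qed.

(** Each term satisfies |<x,f' k>|^2 >= |<x,f k>|^2 / 2 - r^2 |x|^2, so summing
    costs half of the lower frame bound and m r^2, leaving at least A / 4.  The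
    upper bound is the Cauchy-Schwarz inequality. *)
Lemma is_frame_perturb f f' (A r : R) : 0 < A ->
  (forall x, A * hnorm x ^+ 2 <= \sum_(k < m) cabs (dotmx x (f k)) ^+ 2) ->
  (forall k, hnorm (f k - f' k) <= r) -> m%:R * r ^+ 2 <= A / 4 ->
  is_frame f'.
Proof.
move=> A0 Af fr mr.
have F0 : 0 <= \sum_(k < m) hnorm (f' k) ^+ 2.
  by rewrite sumr_ge0 // => k _; rewrite sqr_ge0.
exists (A / 4), (A / 4 + \sum_(k < m) hnorm (f' k) ^+ 2).
split; [lra|split; [by rewrite lerDl|move=> x; split]]; last first.
  rewrite mulrDl; apply: ler_wpDl.
    by rewrite mulr_ge0 ?sqr_ge0 //; lra.
  rewrite mulr_suml; apply: ler_sum => k _.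
  rewrite -exprMn mulrC ler_sqr ?nnegrE ?mulr_ge0 ?hnorm_ge0 ?cabs_ge0 //.
  exact: cabs_dotmx_le.
have step k : cabs (dotmx x (f k)) ^+ 2 / 2 - r ^+ 2 * hnorm x ^+ 2
    <= cabs (dotmx x (f' k)) ^+ 2.
  have tri : cabs (dotmx x (f k)) <=
      cabs (dotmx x (f k - f' k)) + cabs (dotmx x (f' k)).
    have := ler_cabsD (dotmx x (f k - f' k)) (dotmx x (f' k)).
    by rewrite -dotmxDr subrK.
  have dr : cabs (dotmx x (f k - f' k)) <= r * hnorm x.
    apply: le_trans (cabs_dotmx_le _ _) _.
    by rewrite mulrC ler_wpM2r ?hnorm_ge0.
  rewrite -exprMn.
  exact: sqr_half_subr_le (cabs_ge0 _) (cabs_ge0 _) dr tri.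
apply: le_trans (ler_sum _ (fun k _ => step k)).
rewrite sumrB -mulr_suml sumr_const card_ord -[_ *+ m]mulr_natl mulrA.
have := Af x; have := ler_wpM2r (sqr_ge0 (hnorm x)) mr; lra.
Qed.

(** For unit u and v each cross u v (f k) moves by at most
    r (2 |f k| + 1), so the forms of f' cannot all vanish where the sum of the
    forms of f is at least c.  Real rescaling carries this over to arbitrary
    nonzero u and v. *)
Lemma cross_separating_perturb f f' (c r : R) :
  (forall u v, hnorm u = 1 -> hnorm v = 1 -> complex.Im (dotmx u v) = 0 ->
     c <= \sum_(k < m) `|cross u v (f k)|) ->
  (forall k, hnorm (f k - f' k) <= r) -> r <= 1 ->
  r * (\sum_(k < m) (2 * hnorm (f k) + 1)) < c ->
  cross_separating f'.
Proof.
move=> low fr r1 rc u v; rewrite -!hnorm_gt0 => u0 v0 uv.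
apply: contrapT => /forallNP h.
have unit (w : 'rV[R[i]]_n) : 0 < hnorm w -> hnorm ((hnorm w)^-1%:C *: w) = 1.
  move=> w0; rewrite hnormZ /cabs normc_def /= expr0n addr0 sqrtr_sqr.
  by rewrite ger0_norm ?invr_ge0 ?ltW // mulVf ?gt_eqF.
have uv1 : complex.Im (dotmx ((hnorm u)^-1%:C *: u) ((hnorm v)^-1%:C *: v)) = 0.
  by rewrite Im_dotmxZ uv mulr0.
have := low _ _ (unit _ u0) (unit _ v0) uv1; apply/negP; rewrite -ltNge.
apply: le_lt_trans rc; rewrite mulr_sumr; apply: ler_sum => k _.
have -> : cross ((hnorm u)^-1%:C *: u) ((hnorm v)^-1%:C *: v) (f k) =
    cross ((hnorm u)^-1%:C *: u) ((hnorm v)^-1%:C *: v) (f k) -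
    cross ((hnorm u)^-1%:C *: u) ((hnorm v)^-1%:C *: v) (f' k).
  have k0 : cross u v (f' k) = 0 by apply/eqP/negPn/negP/h.
  by rewrite [X in _ = _ - X]crossZ k0 mulr0 subr0.
apply: le_trans (norm_cross_sub_le _ _ (unit _ u0) (unit _ v0)) _.
have d1 : hnorm (f k - f' k) <= 1 by apply: le_trans (fr k) r1.
apply: ler_pM (hnorm_ge0 _) _ (fr k) _; last by rewrite lerD2l.
by rewrite addr_ge0 ?mulr_ge0 ?hnorm_ge0.
Qed.

End Perturbation.

Theorem theorem1p1 (R : realType) (n m : nat) (f : 'I_m -> 'rV[R[i]]_n)
    (hf : phase_retrievable_frame f) :
  exists rho : R, 0 < rho /\
    forall f' : 'I_m -> 'rV[R[i]]_n,
      (forall k : 'I_m, hnorm (f k - f' k) < rho) ->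
      phase_retrievable_frame f'.
Proof.
have [[A [B [A0 [_ AB]]]] inj] := hf.
have [c c0 low] := cross_sum_lower_bound (alpha_inj_cross_separating inj).
pose M := \sum_(k < m) (2 * hnorm (f k) + 1).
have mM : m%:R <= M.
  rewrite -[m%:R]mulr_natl mulr1 -{1}(card_ord m) -sumr_const ler_sum // => k _.
  by rewrite lerDr mulr_ge0 ?hnorm_ge0.
have M1 : 0 < M + 1 by rewrite ltr_wpDl // (le_trans _ mM).
(* The three terms of rho: rho <= 1 linearizes the quadratic error terms,
   rho M < c preserves (S), and m rho^2 <= M rho <= A / 4 the frame bound. *)
pose rho := Num.min 1 (Num.min c (A / 4) / (M + 1)).
have rho0 : 0 < rho.
  by rewrite !lt_min ltr01 divr_gt0 // lt_min c0; lra.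
have rho1 : rho <= 1 by rewrite ge_min lexx.
have rhoM : rho * (M + 1) <= Num.min c (A / 4).
  by rewrite -ler_pdivlMr // ge_min lexx orbT.
move: rhoM; rewrite le_min => /andP[rhoc rhoA].
exists rho; split; first exact: rho0.
move=> f' ff'.
have ff k : hnorm (f k - f' k) <= rho by exact/ltW.
split.
  apply: (is_frame_perturb A0 (fun x => (AB x).1) ff).
  have : m%:R * rho ^+ 2 <= M * rho.
    apply: ler_pM; rewrite ?sqr_ge0 //.
    by rewrite expr2 ler_piMr // ltW.
  lra.
apply: cross_separating_alpha_inj.
apply: (cross_separating_perturb low ff rho1); rewrite -/M; lra.
Qed.
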